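(* Let $X$ and $Y$ be convex-transitive normed spaces, and suppose that $X$ is additionally $L$-like. Then $X\widehat{\bigotimes}_{\pi}Y$ is convex-transitive.
   Context: Spaces are real. $X\widehat{\bigotimes}_{\pi}Y$ is the completion of the algebraic tensor product $X\bigotimes Y$ in the projective norm $\|u\|_{\pi}=\inf\{\sum_{i}\|x_{i}\|_{X}\|y_{i}\|_{Y}:\ u=\sum_{i}x_{i}\otimes y_{i}\}$ (finite sums). A normed space $X$ is convex-transitive if for every $x$ in its unit sphere, $\overline{\mathrm{conv}}\{T(x):T\in\mathcal{G}_X\}$ equals the closed unit ball of $X$, where $\mathcal{G}_X$ is the group of isometric (linear, surjective) automorphisms of $X$. An $L^1$-projection on $X$ is a linear projection $P\colon X\to X$ with $\|x\|=\|Px\|+\|x-Px\|$ for all $x\in X$. $X$ is $L$-like if for each $\epsilon>0$ and $x_{1},\dots,x_{n}\in X$ there are $z_{1},\dots,z_{k}\in X$ and $L^{1}$-projections $P_{1},\dots,P_{k}$ on $X$ such that $\mathrm{dist}(x_{m},\mathrm{span}(z_{i}:1\leq i\leq k))<\epsilon$ for $1\leq m\leq n$, and $P_{i}z_{i}-z_{i}=P_{i}z_{j}=0$ for $1\leq i,j\leq k$, $i\neq j$. *)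

(* Defs.v *)
From HB Require Import structures.
From mathcomp Require Import all_boot all_order all_algebra.
From mathcomp Require Import generic_quotient.
From mathcomp Require Import lra.
From mathcomp Require Import all_classical all_reals all_analysis.

Set Implicit Arguments.
Unset Strict Implicit.
Unset Printing Implicit Defensive.

Import Order.TTheory GRing.Theory Num.Theory.
Import numFieldNormedType.Exports.

Local Open Scope classical_set_scope.
Local Open Scope quotient_scope.
Local Open Scope ring_scope.

(* Algebraic tensor product: formal sums of pairs (x, y), read as
   \sum x (x) y, modulo the congruence generated by bilinearity.  The rule
   0 (x) y = 0 is needed because formal sums only form a monoid; the opposite
   of a class is obtained by scaling by -1. *)
Section tensor.
Context {R : realType} (X Y : lmodType R).
Implicit Types (s t : seq (X * Y)) (x : X) (y : Y).

Inductive tensor_rel : seq (X * Y) -> seq (X * Y) -> Prop :=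
| tensor_rel_refl s : tensor_rel s s
| tensor_rel_sym s t : tensor_rel s t -> tensor_rel t s
| tensor_rel_trans s t r : tensor_rel s t -> tensor_rel t r -> tensor_rel s r
| tensor_rel_cat s s' t t' :
    tensor_rel s s' -> tensor_rel t t' -> tensor_rel (s ++ t) (s' ++ t')
| tensor_rel_catC s t : tensor_rel (s ++ t) (t ++ s)
| tensor_rel_0l y : tensor_rel [:: (0, y)] [::]
| tensor_rel_Dl x x' y : tensor_rel [:: (x + x', y)] [:: (x, y); (x', y)]
| tensor_rel_Dr x y y' : tensor_rel [:: (x, y + y')] [:: (x, y); (x, y')]
| tensor_rel_Z a x y : tensor_rel [:: (a *: x, y)] [:: (x, a *: y)].

Definition tensor_relb s t := `[< tensor_rel s t >].

Let tensor_relb_refl : reflexive tensor_relb.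
Proof. by move=> s; apply/asboolP; exact: tensor_rel_refl. Qed.

Let tensor_relb_sym : symmetric tensor_relb.
Proof.
by move=> s t; apply/idP/idP => /asboolP st; apply/asboolP; exact: tensor_rel_sym.
Qed.

Let tensor_relb_trans : transitive tensor_relb.
Proof.
move=> s t r /asboolP ts /asboolP sr; apply/asboolP.
exact: tensor_rel_trans ts sr.
Qed.

Canonical tensor_equiv :=
  EquivRel tensor_relb tensor_relb_refl tensor_relb_sym tensor_relb_trans.

Definition tensor := {eq_quot tensor_equiv}.
HB.instance Definition _ := Choice.on tensor.

Definition tensor_sum s : tensor := \pi_{eq_quot tensor_equiv} s.
Definition tens x y : tensor := tensor_sum [:: (x, y)].

Definition tensor_repr (u : tensor) : seq (X * Y) :=
  repr (u : {eq_quot tensor_equiv}).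

Lemma tensor_sumP s t : tensor_sum s = tensor_sum t <-> tensor_rel s t.
Proof.
split; first by move/eqmodP => /asboolP.
by move=> st; apply/eqmodP; apply/asboolP.
Qed.

Lemma tensor_reprK u : tensor_sum (tensor_repr u) = u.
Proof. exact: reprK. Qed.

Lemma tensor_sum_repr s : tensor_rel (tensor_repr (tensor_sum s)) s.
Proof. by apply/tensor_sumP; rewrite tensor_reprK. Qed.

Definition tensor_add (u v : tensor) : tensor :=
  tensor_sum (tensor_repr u ++ tensor_repr v).
Definition tensor_scale (a : R) (u : tensor) : tensor :=
  tensor_sum [seq (a *: p.1, p.2) | p <- tensor_repr u].
Definition tensor_zero : tensor := tensor_sum [::].
Definition tensor_opp (u : tensor) : tensor := tensor_scale (- 1) u.

Let scale_rel a s t : tensor_rel s t ->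
  tensor_rel [seq (a *: p.1, p.2) | p <- s] [seq (a *: p.1, p.2) | p <- t].
Proof.
elim=> {s t} /=.
- by move=> s; exact: tensor_rel_refl.
- by move=> s t _; exact: tensor_rel_sym.
- by move=> s t r _ st _; exact: tensor_rel_trans.
- by move=> s s' t t' _ ss' _ tt'; rewrite !map_cat; exact: tensor_rel_cat.
- by move=> s t; rewrite !map_cat; exact: tensor_rel_catC.
- by move=> y; rewrite scaler0; exact: tensor_rel_0l.
- by move=> x x' y; rewrite scalerDr; exact: tensor_rel_Dl.
- by move=> x y y'; exact: tensor_rel_Dr.
- by move=> b x y; rewrite scalerA mulrC -scalerA; exact: tensor_rel_Z.
Qed.

Lemma tensor_addE s t :
  tensor_add (tensor_sum s) (tensor_sum t) = tensor_sum (s ++ t).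
Proof. by apply/tensor_sumP; apply: tensor_rel_cat; exact: tensor_sum_repr. Qed.

Lemma tensor_scaleE a s : tensor_scale a (tensor_sum s) =
  tensor_sum [seq (a *: p.1, p.2) | p <- s].
Proof. by apply/tensor_sumP; apply: scale_rel; exact: tensor_sum_repr. Qed.

Let tensor_addA : associative tensor_add.
Proof.
move=> u v w; rewrite -(tensor_reprK u) -(tensor_reprK v) -(tensor_reprK w).
by rewrite !tensor_addE catA.
Qed.

Let tensor_addC : commutative tensor_add.
Proof. by move=> u v; apply/tensor_sumP; exact: tensor_rel_catC. Qed.

Let tensor_add0 : left_id tensor_zero tensor_add.
Proof. by move=> u; rewrite -(tensor_reprK u) tensor_addE. Qed.

Let tensor_scaleDl u : {morph tensor_scale^~ u : a b / a + b >-> tensor_add a b}.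
Proof.
move=> a b; rewrite -(tensor_reprK u) !tensor_scaleE tensor_addE.
elim: (tensor_repr u) => [//|p s /tensor_sumP ih] /=; apply/tensor_sumP.
rewrite scalerDl -cat1s.
apply: tensor_rel_trans (tensor_rel_cat (tensor_rel_Dl _ _ _) ih) _.
rewrite -(cat1s (a *: p.1, p.2) (_ ++ _)) -(cat1s (a *: p.1, p.2) [:: _]).
rewrite -(cat1s (b *: p.1, p.2) (map _ _)) -!catA.
apply: tensor_rel_cat; first exact: tensor_rel_refl.
rewrite !catA; apply: tensor_rel_cat; last exact: tensor_rel_refl.
exact: tensor_rel_catC.
Qed.

Let tensor_scale0 u : tensor_scale 0 u = tensor_zero.
Proof.
rewrite -(tensor_reprK u) tensor_scaleE.
elim: (tensor_repr u) => [//|p s /tensor_sumP ih] /=; apply/tensor_sumP.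
rewrite scale0r -cat1s -[[::]]cats0; apply: tensor_rel_cat => //.
exact: tensor_rel_0l.
Qed.

Let tensor_scale1 : left_id 1 tensor_scale.
Proof.
move=> u; rewrite -{2}(tensor_reprK u); congr tensor_sum.
by rewrite -[RHS]map_id; apply: eq_map => -[x y]; rewrite scale1r.
Qed.

Let tensor_addN : left_inverse tensor_zero tensor_opp tensor_add.
Proof.
move=> u; rewrite -{2}(tensor_scale1 u) /tensor_opp -tensor_scaleDl.
by rewrite addNr tensor_scale0.
Qed.

HB.instance Definition _ := GRing.isZmodule.Build tensor
  tensor_addA tensor_addC tensor_add0 tensor_addN.

Let tensor_scaleA a b u :
  tensor_scale a (tensor_scale b u) = tensor_scale (a * b) u.
Proof.
rewrite -(tensor_reprK u) !tensor_scaleE -map_comp; congr tensor_sum.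
by apply: eq_map => p /=; rewrite scalerA.
Qed.

Let tensor_scaleDr : right_distributive tensor_scale +%R.
Proof.
move=> a u v; rewrite -(tensor_reprK u) -(tensor_reprK v).
by rewrite [_ + _]tensor_addE !tensor_scaleE map_cat [RHS]tensor_addE.
Qed.

HB.instance Definition _ := GRing.Zmodule_isLmodule.Build R tensor
  tensor_scaleA tensor_scale1 tensor_scaleDr tensor_scaleDl.

Lemma tensor_sum0 : tensor_sum [::] = 0.
Proof. by []. Qed.

Lemma tensor_sum_cat s t : tensor_sum (s ++ t) = tensor_sum s + tensor_sum t.
Proof. by rewrite -tensor_addE. Qed.

Lemma tensor_sumE s : tensor_sum s = \sum_(p <- s) tens p.1 p.2.
Proof.
elim: s => [|[x y] s ih]; first by rewrite big_nil.
by rewrite big_cons -ih -tensor_sum_cat.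
Qed.

Lemma tensor_sumZ a s :
  tensor_sum [seq (a *: p.1, p.2) | p <- s] = a *: tensor_sum s.
Proof. by rewrite -tensor_scaleE. Qed.

Lemma tens_bilinear : bilinear_for *:%R *:%R tens.
Proof.
split=> [y a x x'|x a y y'].
  rewrite /= /tens -tensor_sumZ -tensor_sum_cat /=.
  by apply/tensor_sumP; exact: tensor_rel_Dl.
rewrite /= /tens -tensor_sumZ -tensor_sum_cat /=; apply/tensor_sumP.
apply: tensor_rel_trans (tensor_rel_Dr _ _ _) _.
rewrite -(cat1s (x, a *: y)) -(cat1s (a *: x, y)).
apply: tensor_rel_cat; last exact: tensor_rel_refl.
exact/tensor_rel_sym/tensor_rel_Z.
Qed.

Lemma tensor_universal (W : lmodType R) (f : X -> Y -> W) :
  bilinear_for *:%R *:%R f ->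
  exists g : {linear tensor -> W}, forall x y, g (tens x y) = f x y.
Proof.
move=> [fl fr]; pose F s := \sum_(p <- s) f p.1 p.2.
have fDl y x x' : f (x + x') y = f x y + f x' y.
  by have := fl y 1 x x'; rewrite /= !scale1r.
have fDr y y' x : f x (y + y') = f x y + f x y'.
  by have := fr x 1 y y'; rewrite /= !scale1r.
have f0l y : f 0 y = 0.
  by apply: (addrI (f 0 y)); rewrite -fDl !addr0.
have f0r x : f x 0 = 0.
  by apply: (addrI (f x 0)); rewrite -fDr !addr0.
have fZl a x y : f (a *: x) y = a *: f x y.
  by have := fl y a x 0; rewrite /= f0l !addr0.
have fZr a x y : f x (a *: y) = a *: f x y.
  by have := fr x a y 0; rewrite /= f0r !addr0.
have FE s t : tensor_rel s t -> F s = F t.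
  rewrite /F; elim=> {s t} //=.
  - by move=> s t r _ -> _ ->.
  - by move=> s s' t t' _ ss' _ tt'; rewrite !big_cat/= ss' tt'.
  - by move=> s t; rewrite !big_cat/= addrC.
  - by move=> y; rewrite big_seq1 big_nil /= f0l.
  - by move=> x x' y; rewrite !big_cons !big_nil !addr0 /= fDl.
  - by move=> x y y'; rewrite !big_cons !big_nil !addr0 /= fDr.
  - by move=> a x y; rewrite !big_seq1 /= fZl fZr.
pose G (u : tensor) := F (tensor_repr u).
have GE s : G (tensor_sum s) = F s by apply: FE; exact: tensor_sum_repr.
have Glin : linear G.
  move=> a u v; rewrite -(tensor_reprK u) -(tensor_reprK v).
  rewrite -tensor_sumZ -tensor_sum_cat !GE /F big_cat/= big_map scaler_sumr.
  by congr (_ + _); apply: eq_bigr => p _; rewrite fZl.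
pose GL := GRing.isLinear.Build _ _ _ _ G Glin.
pose g : {linear tensor -> W} := HB.pack G GL.
by exists g => x y; rewrite /g/= GE /F big_seq1.
Qed.

End tensor.

Record seminorm (R : realType) (E : lmodType R) := Seminorm {
  seminorm_fun :> E -> R;
  seminormD : forall x y,
    seminorm_fun (x + y) <= seminorm_fun x + seminorm_fun y;
  seminormZ : forall a x, seminorm_fun (a *: x) = `|a| * seminorm_fun x }.

Section projective_norm.
Context {R : realType} (X Y : normedModType R).
Implicit Types u v : tensor X Y.

Definition formal_cost (s : seq (X * Y)) : R := \sum_(p <- s) `|p.1| * `|p.2|.

Definition proj_norm u : R :=
  inf [set formal_cost s | s in [set s | u = \sum_(p <- s) tens p.1 p.2]].

Lemma formal_cost_ge0 s : 0 <= formal_cost s.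
Proof. by apply: sumr_ge0 => p _; rewrite mulr_ge0. Qed.

Let has_inf_costs u : has_inf
  [set formal_cost s | s in [set s | u = \sum_(p <- s) tens p.1 p.2]].
Proof.
split; last by exists 0 => _ [s _ <-]; exact: formal_cost_ge0.
exists (formal_cost (tensor_repr u)), (tensor_repr u) => //=.
by rewrite -tensor_sumE tensor_reprK.
Qed.

Let proj_norm_le u s : u = \sum_(p <- s) tens p.1 p.2 ->
  proj_norm u <= formal_cost s.
Proof.
by move=> us; apply: ge_inf; [case: (has_inf_costs u)|exists s].
Qed.

Let proj_norm_lt u e : 0 < e -> exists2 s,
  u = \sum_(p <- s) tens p.1 p.2 & formal_cost s < proj_norm u + e.
Proof.
move=> e0; have [_ [s us <-] ?] := inf_adherent e0 (has_inf_costs u).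
by exists s.
Qed.

Lemma proj_normD u v : proj_norm (u + v) <= proj_norm u + proj_norm v.
Proof.
apply/ler_addgt0Pr => e e0; have e20 : 0 < e / 2 by rewrite divr_gt0.
have [s us sle] := proj_norm_lt u e20; have [t vt tle] := proj_norm_lt v e20.
have -> : proj_norm u + proj_norm v + e =
  (proj_norm u + e / 2) + (proj_norm v + e / 2).
  by rewrite addrACA -splitr.
apply: (le_trans (proj_norm_le (s := s ++ t) _)).
  by rewrite big_cat/= us vt.
by rewrite /formal_cost big_cat/= lerD ?ltW.
Qed.

Let proj_normZ_le a u : proj_norm (a *: u) <= `|a| * proj_norm u.
Proof.
apply/ler_addgt0Pr => e e0.
have a1 : 0 < `|a| + 1 by rewrite ltr_wpDl.
have e'0 : 0 < e / (`|a| + 1) by rewrite divr_gt0.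
have [s us sle] := proj_norm_lt u e'0.
apply: (le_trans (proj_norm_le (s := [seq (a *: p.1, p.2) | p <- s]) _)).
  by rewrite -tensor_sumE tensor_sumZ tensor_sumE us.
rewrite /formal_cost big_map/=.
under eq_bigr do rewrite normrZ -mulrA.
rewrite -mulr_sumr; apply: (le_trans (ler_wpM2l (normr_ge0 a) (ltW sle))).
rewrite mulrDr lerD2l mulrCA ler_piMr ?(ltW e0)//.
by rewrite ler_pdivrMr// mul1r lerDl.
Qed.

Lemma proj_normZ a u : proj_norm (a *: u) = `|a| * proj_norm u.
Proof.
apply/eqP; rewrite eq_le proj_normZ_le/=.
have [->|a0] := eqVneq a 0.
  rewrite normr0 mul0r; apply: lb_le_inf; first by case: (has_inf_costs (0 *: u)).
  by move=> _ [s _ <-]; exact: formal_cost_ge0.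
rewrite -ler_pdivlMl ?normr_gt0// -normfV.
by rewrite (le_trans _ (proj_normZ_le _ _))// scalerA mulVf// scale1r.
Qed.

Definition proj_seminorm : seminorm (tensor X Y) :=
  Seminorm proj_normD proj_normZ.

End projective_norm.

(* Completion as Cauchy sequences modulo null sequences.  The construction
   applies to a seminorm and also quotients by its kernel; for the projective
   norm the kernel is 0, a fact that is not needed here. *)
Section completion.
Context {R : realType} {E : lmodType R} (p : seminorm E).
Implicit Types u v : nat -> E.

Definition seminorm_cauchy u := forall e : R, 0 < e ->
  exists N, forall m n, (N <= m)%N -> (N <= n)%N -> p (u m - u n) < e.

Definition seminorm_null u := p (u n) @[n --> \oo] --> (0 : R).

Definition cauchy_seq := {u : nat -> E | `[< seminorm_cauchy u >]}.
HB.instance Definition _ := Choice.on cauchy_seq.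

Definition cauchy_eqb (u v : cauchy_seq) : bool :=
  `[< seminorm_null (fun n => val u n - val v n) >].

Let seminorm0 : p 0 = 0.
Proof. by rewrite -(scale0r 0) seminormZ normr0 mul0r. Qed.

Let seminormN x : p (- x) = p x.
Proof. by rewrite -scaleN1r seminormZ normrN1 mul1r. Qed.

Let seminorm_ge0 x : 0 <= p x.
Proof.
have := seminormD p x (- x); rewrite subrr seminorm0 seminormN.
by rewrite -mulr2n pmulrn_lge0.
Qed.

Let seminormB x y : p (x - y) = p (y - x).
Proof. by rewrite -seminormN opprB. Qed.

Let seminorm_triangle z x y : p (x - y) <= p (x - z) + p (z - y).
Proof. by rewrite (le_trans _ (seminormD _ _ _))// addrA subrK. Qed.

Let nullP u : seminorm_null u <->
  forall e : R, 0 < e -> \forall n \near \oo, p (u n) < e.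
Proof.
split=> [/cvgr0Pnorm_lt h e /h|h].
  by apply: filterS => n; rewrite ger0_norm.
apply/cvgr0Pnorm_lt => e /h.
by apply: filterS => n; rewrite ger0_norm.
Qed.

Let cauchy_eqb_refl : reflexive cauchy_eqb.
Proof.
move=> u; apply/asboolP/nullP => e e0; near=> n.
by rewrite subrr seminorm0.
Unshelve. all: by end_near. Qed.

Let cauchy_eqb_sym : symmetric cauchy_eqb.
Proof.
move=> u v; apply/idP/idP => /asboolP/nullP h; apply/asboolP/nullP => e /h;
  by apply: filterS => n; rewrite seminormB.
Qed.

Let cauchy_eqb_trans : transitive cauchy_eqb.
Proof.
move=> u v w /asboolP/nullP vu /asboolP/nullP uw; apply/asboolP/nullP => e e0.
have e20 : 0 < e / 2 by rewrite divr_gt0.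
near=> n; rewrite (le_lt_trans (seminorm_triangle (val u n) _ _))//.
by rewrite (splitr e) ltrD//; near: n; [exact: vu|exact: uw].
Unshelve. all: by end_near. Qed.

Canonical cauchy_equiv :=
  EquivRel cauchy_eqb cauchy_eqb_refl cauchy_eqb_sym cauchy_eqb_trans.

Definition completion := {eq_quot cauchy_equiv}.
HB.instance Definition _ := Choice.on completion.

Definition cclass u (cu : seminorm_cauchy u) : completion :=
  \pi_{eq_quot cauchy_equiv}
    (exist (fun u => `[< seminorm_cauchy u >]) u (asboolT cu)).

Definition crep (a : completion) : nat -> E :=
  val (repr (a : {eq_quot cauchy_equiv})).

Lemma crep_cauchy a : seminorm_cauchy (crep a).
Proof. by apply/asboolP; exact: (valP (repr (a : {eq_quot cauchy_equiv}))). Qed.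

Lemma cclassP u v (cu : seminorm_cauchy u) (cv : seminorm_cauchy v) :
  cclass cu = cclass cv <-> seminorm_null (fun n => u n - v n).
Proof.
split; first by move/eqmodP => /asboolP.
by move=> uv; apply/eqmodP/asboolP.
Qed.

Lemma crepK a : cclass (crep_cauchy a) = a.
Proof. by rewrite /cclass -[RHS]reprK; congr \pi; exact: val_inj. Qed.

Lemma crep_cclass u (cu : seminorm_cauchy u) :
  seminorm_null (fun n => crep (cclass cu) n - u n).
Proof. by apply/(cclassP (crep_cauchy _) cu); rewrite crepK. Qed.

Lemma cauchyD u v : seminorm_cauchy u -> seminorm_cauchy v ->
  seminorm_cauchy (fun n => u n + v n).
Proof.
move=> cu cv e e0; have e20 : 0 < e / 2 by rewrite divr_gt0.
have [N uN] := cu _ e20; have [M vM] := cv _ e20.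
exists (maxn N M) => m n; rewrite !geq_max => /andP[Nm Mm] /andP[Nn Mn].
rewrite opprD addrACA (le_lt_trans (seminormD _ _ _))// (splitr e).
by rewrite ltrD ?uN ?vM.
Qed.

Lemma cauchyZ a u : seminorm_cauchy u -> seminorm_cauchy (fun n => a *: u n).
Proof.
move=> cu e e0; have a1 : 0 < `|a| + 1 by rewrite ltr_wpDl.
have [N uN] := cu (e / (`|a| + 1)) (divr_gt0 e0 a1).
exists N => m n Nm Nn; rewrite -scalerBr seminormZ.
have := uN _ _ Nm Nn; rewrite ltr_pdivlMr// mulrC; apply: le_lt_trans.
by rewrite ler_wpM2r// lerDl.
Qed.

Lemma cauchy_cst x : seminorm_cauchy (fun=> x).
Proof. by move=> e e0; exists 0%N => m n _ _; rewrite subrr seminorm0. Qed.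

Definition completion_add (a b : completion) : completion :=
  cclass (cauchyD (crep_cauchy a) (crep_cauchy b)).
Definition completion_scale (k : R) (a : completion) : completion :=
  cclass (cauchyZ k (crep_cauchy a)).
Definition completion_zero : completion := cclass (cauchy_cst 0).
Definition completion_opp a := completion_scale (- 1) a.

Definition completion_norm (a : completion) : R := limn (fun n => p (crep a n)).

Let nullD u v : seminorm_null u -> seminorm_null v ->
  seminorm_null (fun n => u n + v n).
Proof.
move=> /nullP nu /nullP nv; apply/nullP => e e0.
have e20 : 0 < e / 2 by rewrite divr_gt0.
near=> n; rewrite (le_lt_trans (seminormD _ _ _))//.
by rewrite (splitr e) ltrD//; near: n; [exact: nu|exact: nv].
Unshelve. all: by end_near. Qed.

Let nullZ a u : seminorm_null u -> seminorm_null (fun n => a *: u n).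
Proof.
move=> nu; rewrite /seminorm_null; under eq_fun do rewrite seminormZ.
by rewrite -(mulr0 `|a|); apply: cvgM; [exact: cvg_cst|exact: nu].
Qed.

Let eq_cclass u v (cu : seminorm_cauchy u) (cv : seminorm_cauchy v) :
  u =1 v -> cclass cu = cclass cv.
Proof.
move=> /funext uv; apply/cclassP; rewrite uv; apply/nullP => e e0.
by near=> n; rewrite subrr seminorm0.
Unshelve. all: by end_near. Qed.

Let addE u v (cu : seminorm_cauchy u) (cv : seminorm_cauchy v) :
  completion_add (cclass cu) (cclass cv) = cclass (cauchyD cu cv).
Proof.
apply/cclassP; have := nullD (crep_cclass cu) (crep_cclass cv).
by under eq_fun do rewrite addrACA -opprD.
Qed.

Let scaleE k u (cu : seminorm_cauchy u) :
  completion_scale k (cclass cu) = cclass (cauchyZ k cu).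
Proof.
by apply/cclassP; have := nullZ k (crep_cclass cu); under eq_fun do rewrite scalerBr.
Qed.

Let completion_addA : associative completion_add.
Proof.
move=> a b c; rewrite -(crepK a) -(crepK b) -(crepK c) !addE.
by apply: eq_cclass => n; rewrite addrA.
Qed.

Let completion_addC : commutative completion_add.
Proof.
move=> a b; rewrite -(crepK a) -(crepK b) !addE.
by apply: eq_cclass => n; rewrite addrC.
Qed.

Let completion_add0 : left_id completion_zero completion_add.
Proof.
by move=> a; rewrite -(crepK a) addE; apply: eq_cclass => n; rewrite add0r.
Qed.

Let completion_addN : left_inverse completion_zero completion_opp completion_add.
Proof.
move=> a; rewrite -(crepK a) /completion_opp scaleE addE; apply: eq_cclass => n.
by rewrite scaleN1r addNr.
Qed.

HB.instance Definition _ := GRing.isZmodule.Build completion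
  completion_addA completion_addC completion_add0 completion_addN.

Let completion_scaleA k l a :
  completion_scale k (completion_scale l a) = completion_scale (k * l) a.
Proof.
by rewrite -(crepK a) !scaleE; apply: eq_cclass => n; rewrite scalerA.
Qed.

Let completion_scale1 : left_id 1 completion_scale.
Proof.
by move=> a; rewrite -(crepK a) scaleE; apply: eq_cclass => n; rewrite scale1r.
Qed.

Let completion_scaleDr : right_distributive completion_scale +%R.
Proof.
move=> k a b; rewrite -(crepK a) -(crepK b) [_ + _]addE !scaleE [RHS]addE.
by apply: eq_cclass => n; rewrite scalerDr.
Qed.

Let completion_scaleDl a :
  {morph completion_scale^~ a : k l / k + l >-> k + l}.
Proof.
move=> k l; rewrite -(crepK a) !scaleE [RHS]addE.
by apply: eq_cclass => n; rewrite scalerDl.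
Qed.

HB.instance Definition _ := GRing.Zmodule_isLmodule.Build R completion
  completion_scaleA completion_scale1 completion_scaleDr completion_scaleDl.

Lemma cclassD u v (cu : seminorm_cauchy u) (cv : seminorm_cauchy v) :
  cclass cu + cclass cv = cclass (cauchyD cu cv).
Proof. exact: addE. Qed.

Lemma cclassZ k u (cu : seminorm_cauchy u) :
  k *: cclass cu = cclass (cauchyZ k cu).
Proof. exact: scaleE. Qed.

Let seminorm_dist x y : `|p x - p y| <= p (x - y).
Proof.
have le1 a b : p a - p b <= p (a - b).
  by rewrite lerBlDr (le_trans _ (seminormD _ _ _))// subrK.
by rewrite ler_norml le1 andbT lerNl opprB seminormB le1.
Qed.

Let cvg_seminorm u : seminorm_cauchy u -> cvgn (fun n => p (u n)).
Proof.
move=> cu; apply/cauchy_cvgP/cauchy_exP => e e0; have [N uN] := cu _ e0.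
exists (p (u N)); exists N => // n /= Nn.
rewrite /ball/= (le_lt_trans (seminorm_dist _ _))//.
by rewrite uN/=.
Qed.

Lemma cvg_cclass u (cu : seminorm_cauchy u) :
  p (u n) @[n --> \oo] --> completion_norm (cclass cu).
Proof.
have h := cvg_seminorm (crep_cauchy (cclass cu)).
suff /cvg_lim : p (crep (cclass cu) n) @[n --> \oo] --> limn (fun n => p (u n)).
  by rewrite /completion_norm => ->//; exact: cvg_seminorm.
have -> : (fun n => p (crep (cclass cu) n)) =
    (fun n => p (u n) + (p (crep (cclass cu) n) - p (u n))).
  by apply/funext => n; rewrite addrC subrK.
rewrite -[X in _ --> X]addr0; apply: cvgD; first exact: cvg_seminorm.
apply: norm_cvg0; apply: squeeze_cvgr (crep_cclass cu); last exact: cvg_cst.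
by near=> n; rewrite normr_ge0 seminorm_dist.
Unshelve. all: by end_near. Qed.

Arguments cvg_cclass : clear implicits.

Let completion_normD a b :
  completion_norm (a + b) <= completion_norm a + completion_norm b.
Proof.
rewrite -(crepK a) -(crepK b) cclassD.
set ca := crep_cauchy a; set cb := crep_cauchy b.
have cD : p (crep a n) + p (crep b n) @[n --> \oo] -->
    completion_norm (cclass ca) + completion_norm (cclass cb).
  by apply: cvgD; exact: cvg_cclass.
apply: (ler_cvg_to (cvg_cclass _ (cauchyD ca cb)) cD).
by near=> n; exact: seminormD.
Unshelve. all: by end_near. Qed.

Let completion_normZ k a : completion_norm (k *: a) = `|k| * completion_norm a.
Proof.
rewrite -(crepK a) cclassZ; apply: cvg_unique (cvg_cclass _ _) _ => //=.
under eq_fun do rewrite seminormZ.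
by apply: cvgM; [exact: cvg_cst|exact: cvg_cclass].
Qed.

Let completion_norm_eq0 a : completion_norm a = 0 -> a = 0.
Proof.
rewrite -(crepK a) => a0; apply/cclassP.
have := cvg_cclass _ (crep_cauchy a); rewrite a0.
by rewrite /seminorm_null; under [in X in _ -> X]eq_fun do rewrite subr0.
Qed.

HB.instance Definition _ := Lmodule_isNormed.Build R completion
  completion_normD completion_normZ completion_norm_eq0.

Definition completion_inj (x : E) : completion := cclass (cauchy_cst x).

Lemma completion_inj_linear : linear completion_inj.
Proof.
by move=> k x y; rewrite /completion_inj cclassZ cclassD; exact: eq_cclass.
Qed.

HB.instance Definition _ := GRing.isLinear.Build R E completion _
  completion_inj completion_inj_linear.

Lemma cvg_norm_cclass u (cu : seminorm_cauchy u) :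
  p (u n) @[n --> \oo] --> `|cclass cu|.
Proof. exact: cvg_cclass. Qed.

Arguments cvg_norm_cclass : clear implicits.

Lemma norm_completion_inj x : `|completion_inj x| = p x.
Proof. by apply: cvg_unique (cvg_norm_cclass _ _) _ => //; exact: cvg_cst. Qed.

Lemma cvg_completion_inj u (cu : seminorm_cauchy u) :
  completion_inj (u n) @[n --> \oo] --> cclass cu.
Proof.
apply/cvgrPdist_le => e e0; have [N uN] := cu _ e0.
exists N => // n /= Nn.
have -> : cclass cu - completion_inj (u n) =
    cclass (cauchyD cu (cauchyZ (-1) (cauchy_cst (u n)))).
  by rewrite -scaleN1r cclassZ cclassD.
apply: (ler_cvg_to (cvg_norm_cclass _ _) (cvg_cst e)).
exists N => // m /= Nm; rewrite scaleN1r ltW//.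
exact: uN.
Qed.

Arguments cvg_completion_inj : clear implicits.

Lemma completion_inj_dense : closure (range completion_inj) = setT.
Proof.
apply/seteqP; split=> // a _ B Ba.
have := cvg_completion_inj _ (crep_cauchy a); rewrite crepK => /(_ _ Ba)[N _ NB].
by exists (completion_inj (crep a N)); split; [exists (crep a N)|exact: NB (leqnn N)].
Qed.

Let completion_complete (F : set_system completion) :
  ProperFilter F -> cauchy F -> cvg F.
Proof.
move=> FF /cauchyP Fc.
have d0 n : 0 < n.+1%:R^-1 :> R by rewrite invr_gt0.
have /choice[a aF] : forall n : nat, exists a, F (ball a n.+1%:R^-1).
  by move=> n; exact: Fc (d0 n).
have /choice[x xa] n : exists x, `|a n - completion_inj x| < n.+1%:R^-1.
  have := cvg_completion_inj _ (crep_cauchy (a n)); rewrite crepK.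
  move=> /cvgrPdist_lt/(_ _ (d0 n))[N _ NB].
  by exists (crep (a n) N); exact: NB (leqnn N).
have small e : 0 < e -> exists N, forall n, (N <= n)%N -> n.+1%:R^-1 < e :> R.
  move=> e0; have [N _ NB] := near_infty_natSinv_lt (PosNum e0).
  by exists N => n Nn; exact: NB.
have cx : seminorm_cauchy x.
  move=> e e0; have [N Ne] := small (e / 4) (divr_gt0 e0 (ltr0n _ 4)).
  exists N => m n Nm Nn; rewrite -norm_completion_inj linearB/=.
  have [b [abm abn]] := filter_ex (filterI (aF m) (aF n)).
  move: abm abn; rewrite -!ball_normE/= => abm abn.
  have := xa m; have := xa n; have := Ne m Nm; have := Ne n Nn.
  set em := m.+1%:R^-1; set en := n.+1%:R^-1 => h1 h2 h3 h4.
  have -> : completion_inj (x m) - completion_inj (x n) =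
    - (a m - completion_inj (x m)) + (a m - b) - (a n - b)
      + (a n - completion_inj (x n)).
    by rewrite !opprB !addrA !subrK.
  apply: (le_lt_trans (ler_normD _ _)).
  apply: (@lt_le_trans _ _ (e / 4 + e / 4 + e / 4 + e / 4)); last first.
    by lra.
  apply: ltrD; last exact: lt_trans h3 h1.
  apply: (le_lt_trans (ler_normB _ _)); apply: ltrD; last exact: lt_trans abn h1.
  apply: (le_lt_trans (ler_normD _ _)).
  by rewrite normrN; apply: ltrD; [exact: lt_trans h4 h2|exact: lt_trans abm h2].
apply/cvg_ex; exists (cclass cx); apply/fcvgrPdist_lt => e e0.
have e30 : 0 < e / 3 by rewrite divr_gt0.
have [N Ne] := small _ e30.
have /cvgrPdist_lt/(_ _ e30)[M _ MB] := cvg_completion_inj _ cx.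
pose n := maxn N M.
have {Ne}ne := Ne n (leq_maxl _ _).
have {MB}xn := MB n (leq_maxr _ _).
apply: filterS (aF n) => b; rewrite -ball_normE/= => ab.
have -> : cclass cx - b = (cclass cx - completion_inj (x n))
    - (a n - completion_inj (x n)) + (a n - b).
  by rewrite !opprB !addrA !subrK.
have -> : e = e / 3 + e / 3 + e / 3.
  by lra.
apply: (le_lt_trans (ler_normD _ _)); apply: ltrD; last exact: lt_trans ab ne.
apply: (le_lt_trans (ler_normB _ _)); apply: ltrD => //.
exact: lt_trans (xa n) ne.
Qed.

HB.instance Definition _ := Uniform_isComplete.Build completion completion_complete.

End completion.

(* The completed projective tensor product of X and Y. *)
Definition proj_tensor {R : realType} (X Y : normedModType R) :
    completeNormedModType R :=
  completion (proj_seminorm X Y).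

Section convex_transitivity.
Context {R : realType} (V : normedModType R).

Definition conv_hull (A : set V) : set V :=
  [set x | exists (n : nat) (c : 'I_n -> R) (a : 'I_n -> V),
    [/\ forall i, 0 <= c i, \sum_(i < n) c i = 1, forall i, A (a i) &
        x = \sum_(i < n) c i *: a i]].

Definition isometric_automorphisms : set {linear V -> V} :=
  [set T | (forall x, `|T x| = `|x|) /\ range T = setT].

Definition convex_transitive : Prop :=
  forall x : V, `|x| = 1 ->
    closure (conv_hull [set T x | T in isometric_automorphisms]) =
    [set y | `|y| <= 1].

Definition L1_projection (P : {linear V -> V}) : Prop :=
  (forall x, P (P x) = P x) /\ (forall x, `|x| = `|P x| + `|x - P x|).

Definition lin_span k (z : 'I_k -> V) : set V :=
  range (fun c : 'I_k -> R => \sum_(i < k) c i *: z i).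

Definition L_like : Prop :=
  forall (e : R) (n : nat) (x : 'I_n -> V), 0 < e ->
    exists (k : nat) (z : 'I_k -> V) (P : 'I_k -> {linear V -> V}),
      [/\ forall i, L1_projection (P i),
          forall m, (edist_inf (lin_span z) (x m) < e%:E)%E,
          forall i, P i (z i) - z i = 0 &
          forall i j, i != j -> P i (z j) = 0].

End convex_transitivity.

(* Main.v *)
(** Let u be a unit vector and K the closed convex hull of its orbit.  By
    L-likeness u is close to some v = \sum_i z_i (x) y_i whose z_i are separated
    by L^1-projections P_i.  For an isometry T of Y the map
    P_i (x) T + (1 - P_i) (x) 1 is an isometry of the tensor product, because
    |P_i x| + |x - P_i x| = |x| makes it a contraction and T^-1 gives its
    inverse; it sends z_i (x) y_i to z_i (x) T y_i and fixes the other terms of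
    v.  Since Y is convex-transitive, each y_i may thus be replaced in turn by |y_i| y0 for one
    fixed unit vector y0, so that v becomes x1 (x) y0 with
    x1 = \sum_i |y_i| z_i.  The z_i span a copy of l^1, so
    |x1| = \sum_i |y_i| |z_i| >= |v|, and convex transitivity of X moves
    x1 (x) y0 to x (x) y0 for every |x| <= |v|.  Hence K contains, up to small
    errors, all x (x) y with |x| |y| <= 1, whose closed convex hull is the unit
    ball. *)

From HB Require Import structures.
Require Import Defs.
From mathcomp Require Import all_boot all_order all_algebra.
From mathcomp Require Import all_classical all_reals all_analysis.
From mathcomp Require Import ring lra.

Set Implicit Arguments.
Unset Strict Implicit.
Unset Printing Implicit Defensive.

Import Order.TTheory GRing.Theory Num.Theory.
Import numFieldNormedType.Exports.

Local Open Scope classical_set_scope.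
Local Open Scope ring_scope.

Lemma linear_funP (R : realType) (V W : lmodType R) (f : V -> W) :
  linear f -> exists g : {linear V -> W}, g =1 f.
Proof.
move=> flin; pose fL := GRing.isLinear.Build _ _ _ _ f flin.
by pose g : {linear V -> W} := HB.pack f fL; exists g.
Qed.

(** * Closed convex hulls, neighbourhoods and orbits under isometric automorphisms *)

Section closed_convex.
Context {R : realType} {V : normedModType R}.
Implicit Types (A K : set V) (x y : V).

(** The open [e]-neighbourhood of [K]. It absorbs approximation errors while keeping convexity and
    invariance under isometries. *)
Definition fatten K (e : R) : set V := [set x | exists2 a, K a & `|x - a| < e].

Lemma closureP A x : closure A x <-> forall e : R, 0 < e -> fatten A e x.
Proof.
split=> [Ax e e0|Ax B].
  have [a [Aa]] := Ax _ (nbhsx_ballx x e e0).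
  by rewrite -ball_normE /= => xa; exists a.
rewrite -nbhs_ballE => -[e /= e0 eB]; have [a Aa xa] := Ax _ e0.
by exists a; split => //; apply: eB; rewrite -ball_normE.
Qed.

Definition convex K := forall (s t : R) x y,
  0 <= s -> 0 <= t -> s + t = 1 -> K x -> K y -> K (s *: x + t *: y).

(** Convexity with unnormalised weights, the form that survives induction over a sum; if
    [a + b = 0], both weights vanish and any point of [K] serves. *)
Lemma convex_cone K (a b : R) x y : convex K -> 0 <= a -> 0 <= b ->
  K x -> K y -> exists2 z, K z & a *: x + b *: y = (a + b) *: z.
Proof.
move=> cK a0 b0 Kx Ky; have [ab|ab] := eqVneq (a + b) 0.
  have /andP[/eqP -> /eqP ->] : (a == 0) && (b == 0) by rewrite -paddr_eq0 ?ab.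
  by exists x => //; rewrite addr0 !scale0r addr0.
exists ((a / (a + b)) *: x + (b / (a + b)) *: y).
  by apply: cK => //; [rewrite divr_ge0 ?addr_ge0..|rewrite -mulrDl divff].
by rewrite scalerDr !scalerA !(mulrCA (a + b)) divff// !mulr1.
Qed.

Lemma convex_sum K (I : Type) (r : seq I) (c : I -> R) (f : I -> V) :
  convex K -> K !=set0 -> (forall i, 0 <= c i) -> (forall i, K (f i)) ->
  exists2 z, K z & \sum_(i <- r) c i *: f i = (\sum_(i <- r) c i) *: z.
Proof.
move=> cK [k0 Kk0] c0 Kf; elim: r => [|i r [z Kz zE]].
  by exists k0 => //; rewrite !big_nil scale0r.
rewrite !big_cons zE; apply: convex_cone => //.
by apply: sumr_ge0 => j _.
Qed.

Lemma conv_hull_sub A K : convex K -> A `<=` K -> conv_hull A `<=` K.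
Proof.
move=> cK AK _ [n [c [a [c0 c1 Aa ->]]]].
case: n c a c0 c1 Aa => [c a _|n c a c0 c1 Aa].
  by rewrite big_ord0 => /esym/eqP; rewrite oner_eq0.
have [] := @convex_sum K _ (index_enum 'I_n.+1) c a cK.
- by exists (a ord0); exact: AK.
- exact: c0.
- by move=> i; exact: AK.
by move=> z Kz ->; rewrite c1 scale1r.
Qed.

Lemma sub_conv_hull A : A `<=` conv_hull A.
Proof.
move=> x Ax; exists 1%N, (fun=> 1), (fun=> x); split => //.
  by rewrite big_ord1.
by rewrite big_ord1 scale1r.
Qed.

Lemma convex_conv_hull A : convex (conv_hull A).
Proof.
move=> s t _ _ s0 t0 st [n [c [a [c0 c1 Aa ->]]]] [m [d [b [d0 d1 Ab ->]]]].
(* Two convex combinations merge into one by concatenating their index sets, with weights rescaled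
   by [s] and [t]. *)
pose glue T (f : 'I_n -> T) (g : 'I_m -> T) (i : 'I_(n + m)) :=
  match fintype.split i with inl j => f j | inr j => g j end.
have gluel T f g j : @glue T f g (lshift m j) = f j.
  by rewrite /glue (unsplitK (inl j : 'I_n + 'I_m)).
have gluer T f g j : @glue T f g (rshift n j) = g j.
  by rewrite /glue (unsplitK (inr j : 'I_n + 'I_m)).
exists (n + m)%N, (glue _ (fun i => s * c i) (fun i => t * d i)), (glue _ a b).
split.
- by move=> i; rewrite /glue; case: fintype.split => j; rewrite mulr_ge0.
- rewrite big_split_ord /= -st.
  transitivity (s * (\sum_(i < n) c i) + t * (\sum_(i < m) d i)); last first.
    by rewrite c1 d1 !mulr1.
  rewrite !mulr_sumr.
  by congr (_ + _); apply: eq_bigr => j _; rewrite ?gluel ?gluer.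
- by move=> i; rewrite /glue; case: fintype.split => j.
rewrite big_split_ord /= !scaler_sumr.
by congr (_ + _); apply: eq_bigr => j _; rewrite ?gluel ?gluer scalerA.
Qed.

Lemma convex_fatten K e : convex K -> convex (fatten K e).
Proof.
move=> cK s t x y s0 t0 st [a Ka xa] [b Kb yb].
exists (s *: a + t *: b); first exact: cK.
rewrite opprD addrACA -!scalerBr (le_lt_trans (ler_normD _ _))//.
rewrite !normrZ !ger0_norm//.
(* The strict bound survives multiplication by [s] only if [s] is positive; for [s = 0] it comes
   from the second summand. *)
have [s_eq0|s_neq0] := eqVneq s 0.
  have -> : t = 1 by have := st; lra.
  by rewrite s_eq0 mul0r add0r mul1r.
have sp : 0 < s by rewrite lt_neqAle eq_sym s_neq0.
have -> : e = s * e + t * e by rewrite -mulrDl st mul1r.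
by rewrite ltr_leD ?ltr_pM2l// ler_wpM2l// ltW.
Qed.

Lemma convex_closure K : convex K -> convex (closure K).
Proof.
move=> cK s t x y s0 t0 st /closureP Kx /closureP Ky; apply/closureP => e e0.
by apply: convex_fatten => //; [exact: Kx|exact: Ky].
Qed.

Lemma closed_convex_hull_sub A K : closed K -> convex K -> A `<=` K ->
  closure (conv_hull A) `<=` K.
Proof.
move=> clK cK AK; rewrite [X in _ `<=` X]((closure_id K).1 clK).
by apply: closureS; exact: conv_hull_sub.
Qed.

Definition isom_invariant K :=
  forall T : {linear V -> V}, isometric_automorphisms T ->
  forall x, K x -> K (T x).

Lemma isom_invariant_fatten K e :
  isom_invariant K -> isom_invariant (fatten K e).
Proof.
move=> iK T Tiso x [a Ka xa]; exists (T a); first exact: iK.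
by rewrite -linearB Tiso.1.
Qed.

Lemma isom_invariant_closure K :
  isom_invariant K -> isom_invariant (closure K).
Proof.
move=> iK T Tiso x /closureP Kx; apply/closureP => e e0.
by apply: isom_invariant_fatten => //; exact: Kx.
Qed.

Lemma isometric_automorphism_id :
  exists2 T : {linear V -> V}, isometric_automorphisms T & T =1 id.
Proof.
have [T TE] : exists T : {linear V -> V}, T =1 id by exact: linear_funP.
exists T => //; split=> [x|]; first by rewrite TE.
by apply/seteqP; split => // y _; exists y => //; rewrite TE.
Qed.

Lemma isometric_automorphism_comp (S T : {linear V -> V}) :
  isometric_automorphisms S -> isometric_automorphisms T ->
  isometric_automorphisms (S \o T : {linear V -> V}).
Proof.
move=> [Sn Ss] [Tn Ts]; split=> [x|]; first by rewrite /= Sn Tn.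
apply/seteqP; split=> // z _.
have [y _ <-] : range S z by rewrite Ss.
have [x _ <-] : range T y by rewrite Ts.
by exists x.
Qed.

Lemma isometric_automorphism_inv (T : {linear V -> V}) :
  isometric_automorphisms T ->
  exists S : {linear V -> V},
    [/\ isometric_automorphisms S, cancel T S & cancel S T].
Proof.
move=> [Tn Ts].
have /choice[s sK] : forall y, exists x, T x = y.
  move=> y; have [x _ <-] : range T y by rewrite Ts.
  by exists x.
have Tinj x y : T x = T y -> x = y.
  move=> Txy; apply/eqP; rewrite -subr_eq0 -normr_eq0 -Tn linearB /=.
  by rewrite Txy subrr normr0.
have [S SE] : exists S : {linear V -> V}, S =1 s.
  by apply: linear_funP => a x y; apply: Tinj; rewrite linearP !sK.
have TS : cancel S T by move=> y; rewrite SE sK.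
have ST : cancel T S by move=> x; apply: Tinj; rewrite TS.
exists S; split => //; split=> [x|]; first by rewrite -[LHS]Tn TS.
by apply/seteqP; split => // x _; exists (T x).
Qed.

(** Convex-transitivity says that this set is the closed unit ball whenever [x] is a unit vector. *)
Definition orbit_hull x : set V :=
  closure (conv_hull [set T x | T in isometric_automorphisms (V := V)]).

Lemma orbit_hull_refl x : orbit_hull x x.
Proof.
apply: subset_closure; apply: sub_conv_hull.
by have [T Tiso TE] := isometric_automorphism_id; exists T => //; rewrite TE.
Qed.

Lemma convex_orbit_hull x : convex (orbit_hull x).
Proof. by apply: convex_closure; exact: convex_conv_hull. Qed.

Lemma isom_invariant_orbit_hull x : isom_invariant (orbit_hull x).
Proof.
apply: isom_invariant_closure => T Tiso _ [n [c [a [c0 c1 Aa ->]]]].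
exists n, c, (T \o a); split=> // [i|].
  have [S Siso Sx] := Aa i.
  exists (T \o S : {linear V -> V}); first exact: isometric_automorphism_comp.
  by rewrite /= Sx.
by rewrite linear_sum; apply: eq_bigr => i _; rewrite linearZ.
Qed.

(** The closed ball of radius [|x|] is closed, convex and contains the orbit of [x]. *)
Lemma orbit_hull_norm x y : orbit_hull x y -> `|y| <= `|x|.
Proof.
move: y; apply: (@closed_convex_hull_sub _ [set y | `|y| <= `|x|]).
- move=> y /closureP xy; apply/ler_addgt0Pr => e e0.
  have [a /= ax ya] := xy _ e0.
  rewrite -(subrK a y) (le_trans (ler_normD _ _))// addrC.
  by rewrite lerD// ltW.
- move=> s t y z s0 t0 st /= yx zx; rewrite (le_trans (ler_normD _ _))//.
  rewrite !normrZ !ger0_norm//.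
  by rewrite -[leRHS]mul1r -st mulrDl lerD// ler_wpM2l.
- by move=> _ [T [Tn _] <-] /=; rewrite Tn.
Qed.

End closed_convex.

(** * Convex-transitivity tested against closed convex sets *)

Lemma closed_preimage_lip (R : realType) (V W : normedModType R) (K : set V)
    (f : W -> V) (c : R) :
  closed K -> (forall u v, `|f u - f v| <= c * `|u - v|) ->
  closed [set x | K (f x)].
Proof.
move=> clK lip x /closureP Kx; apply: clK; apply/closureP => e e0.
(* Dividing by [|c| + 1] instead of [c] avoids assuming that [c] is nonzero. *)
have c1 : 0 < `|c| + 1 by rewrite ltr_wpDl.
have [a Ka xa] := Kx (e / (`|c| + 1)) (divr_gt0 e0 c1).
exists (f a) => //; apply: (le_lt_trans (lip _ _)).
move: xa; rewrite ltr_pdivlMr// mulrC; apply: le_lt_trans.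
by rewrite ler_wpM2r// ltW// (le_lt_trans (ler_norm c))// ltrDl.
Qed.

(** The form in which convex-transitivity is applied: rescaling by [|x|] frees it from the unit
    sphere, and [K] may be any closed convex set containing the orbit of [x], such as the preimage
    of a set in the tensor product. *)
Lemma convex_transitive_sub (R : realType) (V : normedModType R) (K : set V)
    (x y : V) :
  convex_transitive V -> closed K -> convex K ->
  (forall T : {linear V -> V}, isometric_automorphisms T -> K (T x)) ->
  `|y| <= `|x| -> K y.
Proof.
move=> trV clK cK KT yx; have [x0|x_neq0] := eqVneq x 0.
  have [T Tiso TE] := @isometric_automorphism_id R V.
  move: yx; rewrite x0 normr0 normr_le0 => /eqP ->.
  by have := KT T Tiso; rewrite TE x0.
have nx : 0 < `|x| by rewrite normr_gt0.
pose K' := [set z | K (`|x| *: z)].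
suff : K' (`|x|^-1 *: y) by rewrite /K' /= scalerA divff ?scale1r// gt_eqF.
have x1 : `| `|x|^-1 *: x| = 1.
  by rewrite normrZ normfV normr_id mulVf// gt_eqF.
apply: (@closed_convex_hull_sub _ _
  [set T (`|x|^-1 *: x) | T in isometric_automorphisms (V := V)] K').
- refine (closed_preimage_lip (f := fun z => `|x| *: z) (c := `|x|) clK _) => u v.
  by rewrite -scalerBr normrZ normr_id.
- move=> s t u v s0 t0 st Ku Kv; rewrite /K' /= scalerDr !scalerA.
  by rewrite !(mulrC `|x|) -!scalerA; exact: cK.
- move=> _ [T Tiso <-]; rewrite /K' /= linearZ scalerA divff ?gt_eqF//.
  by rewrite scale1r; exact: KT.
rewrite trV //= normrZ normfV normr_id mulrC ler_pdivrMr// mul1r //.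
Qed.


(** * Extension of isometries to the completion *)

Section completion_isometry.
Context {R : realType} {E : lmodType R} (p : seminorm E).

Lemma eq_cclass (u v : nat -> E) (cu : seminorm_cauchy p u)
    (cv : seminorm_cauchy p v) : u =1 v -> cclass cu = cclass cv.
Proof.
move=> /funext uv; case: _ / uv cv => cv.
by congr cclass; exact: Prop_irrelevance.
Qed.

(** Two mutually inverse contractions preserve [p]. Acting termwise on Cauchy sequences, [F] then
    respects null differences and keeps limits of norms, while [G] provides preimages. *)
Lemma completion_isometry (F G : {linear E -> E}) :
  (forall x, p (F x) <= p x) -> (forall x, p (G x) <= p x) ->
  cancel F G -> cancel G F ->
  exists2 S : {linear completion p -> completion p},
    isometric_automorphisms S &
    forall x, S (completion_inj p x) = completion_inj p (F x).
Proof.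
move=> Fle Gle FK GK.
have pF x : p (F x) = p x by apply/eqP; rewrite eq_le Fle -{1}(FK x) Gle.
have cauchyF (H : {linear E -> E}) u : (forall x, p (H x) <= p x) ->
    seminorm_cauchy p u -> seminorm_cauchy p (H \o u).
  move=> Hle cu e e0; have [N uN] := cu e e0; exists N => m n Nm Nn.
  by rewrite /= -linearB (le_lt_trans (Hle _))// uN.
pose Sf (a : completion p) := cclass (cauchyF F _ Fle (crep_cauchy a)).
have SfE u (cu : seminorm_cauchy p u) :
    Sf (cclass cu) = cclass (cauchyF F u Fle cu).
  apply/cclassP; rewrite /seminorm_null.
  have -> : (fun n => p ((F \o crep (cclass cu)) n - (F \o u) n)) =
      (fun n => p (crep (cclass cu) n - u n)).
    by apply/funext => n; rewrite /= -linearB pF.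
  exact: crep_cclass.
have Sflin : linear Sf.
  move=> k a b; rewrite -(crepK a) -(crepK b) cclassZ cclassD !SfE.
  by rewrite cclassZ cclassD; apply: eq_cclass => n /=; rewrite linearP.
have [S SE] := linear_funP Sflin.
exists S; last by move=> x; rewrite SE SfE; exact: eq_cclass.
split=> [a|].
  have := @cvg_norm_cclass _ _ _ _ (crep_cauchy a); rewrite crepK => pa.
  rewrite SE; apply: cvg_unique (@cvg_norm_cclass _ _ _ _ _) _ => //.
  have -> : (fun n => p ((F \o crep a) n)) = (fun n => p (crep a n)).
    by apply/funext => n; rewrite /= pF.
  exact: pa.
apply/seteqP; split => // a _.
exists (cclass (cauchyF G _ Gle (crep_cauchy a))) => //.
by rewrite SE SfE -[RHS]crepK; apply: eq_cclass => n /=; rewrite GK.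
Qed.

End completion_isometry.

(** * Linearity of elementary tensors in each factor *)

Section tensor_linear.
Context {R : realType} {X Y : lmodType R}.
Implicit Types (x : X) (y : Y).

Lemma tens_linearl y : linear (fun x => tens x y : tensor X Y).
Proof. by move=> a x x'; exact: (@tens_bilinear R X Y).1. Qed.

Lemma tens_linearr x : linear (fun y => tens x y : tensor X Y).
Proof. by move=> a y y'; exact: (@tens_bilinear R X Y).2. Qed.

HB.instance Definition _ x :=
  GRing.isLinear.Build R Y (tensor X Y) _ (tens x) (tens_linearr x).

(** The arguments of [tens] are swapped so that linearity in the first factor can be attached to a
    partial application. *)
Definition tensl y x : tensor X Y := tens x y.
HB.instance Definition _ y :=
  GRing.isLinear.Build R X (tensor X Y) _ (tensl y) (tens_linearl y).

Lemma tensZl a x y : tens (a *: x) y = a *: tens x y.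
Proof. exact: (linearZZ (tensl y)). Qed.

Lemma tensZr a x y : tens x (a *: y) = a *: tens x y.
Proof. exact: (linearZZ (tens x)). Qed.

Lemma tens_suml I (r : seq I) (f : I -> X) y :
  tens (\sum_(i <- r) f i) y = \sum_(i <- r) tens (f i) y.
Proof. exact: (linear_sum (tensl y)). Qed.

Lemma tens0l y : tens 0 y = 0 :> tensor X Y.
Proof. exact: (linear0 (tensl y)). Qed.

Lemma tensDl x x' y : tens (x + x') y = tens x y + tens x' y.
Proof. exact: (linearD (tensl y)). Qed.

Lemma tensor_eq_sum (u : tensor X Y) : exists s : seq (X * Y),
  u = \sum_(p <- s) tens p.1 p.2.
Proof. by exists (tensor_repr u); rewrite -tensor_sumE tensor_reprK. Qed.

Lemma tensor_map (A : {linear X -> X}) (B : {linear Y -> Y}) :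
  exists F : {linear tensor X Y -> tensor X Y},
    forall x y, F (tens x y) = tens (A x) (B y).
Proof.
apply: tensor_universal; split=> [y a x x'|x a y y'] /=.
  by rewrite linearP; exact: tens_linearl.
by rewrite linearP; exact: tens_linearr.
Qed.

End tensor_linear.

(** * Isometries of the projective tensor product *)

Section projective_isometries.
Context {R : realType} {X Y : normedModType R}.
Implicit Types (x : X) (y : Y) (u : tensor X Y).
Local Notation inj := (completion_inj (proj_seminorm X Y)).

Lemma proj_norm_le_cost (s : seq (X * Y)) :
  proj_norm (\sum_(p <- s) tens p.1 p.2) <= formal_cost s.
Proof.
apply: ge_inf; last by exists s.
by exists 0 => _ [t _ <-]; exact: formal_cost_ge0.
Qed.

Lemma proj_norm_tens x y : proj_norm (tens x y) <= `|x| * `|y|.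
Proof.
have := proj_norm_le_cost [:: (x, y)].
by rewrite /formal_cost !big_seq1.
Qed.

Lemma proj_norm_lt u (e : R) : proj_norm u < e ->
  exists2 s : seq (X * Y), u = \sum_(p <- s) tens p.1 p.2 & formal_cost s < e.
Proof.
move=> ue; have [|_ [s us <-] sc] := inf_lt _ ue; last by exists s.
by have [s us] := tensor_eq_sum u; exists (formal_cost s), s.
Qed.

Lemma proj_norm_sum I (r : seq I) (f : I -> tensor X Y) :
  proj_norm (\sum_(i <- r) f i) <= \sum_(i <- r) proj_norm (f i).
Proof.
have N0 : proj_norm (0 : tensor X Y) = 0.
  by rewrite -(scale0r 0) proj_normZ normr0 mul0r.
elim: r => [|i r ih]; first by rewrite !big_nil N0.
by rewrite !big_cons (le_trans (proj_normD _ _))// lerD2l.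
Qed.

(** Elementary tensors suffice: applying [F] to the terms of a representation of nearly minimal cost
    gives a sum whose norm is at most that cost. *)
Lemma proj_norm_contraction (F : {linear tensor X Y -> tensor X Y}) :
  (forall x y, proj_norm (F (tens x y)) <= `|x| * `|y|) ->
  forall u, proj_norm (F u) <= proj_norm u.
Proof.
move=> Fle u; apply/ler_addgt0Pr => e e0.
have [|s -> /ltW] := @proj_norm_lt u (proj_norm u + e); first by rewrite ltrDl.
apply: le_trans; rewrite linear_sum (le_trans (proj_norm_sum _ _))//.
exact: ler_sum.
Qed.

Lemma proj_tensor_isometry (F G : {linear tensor X Y -> tensor X Y}) :
  (forall x y, proj_norm (F (tens x y)) <= `|x| * `|y|) ->
  (forall x y, proj_norm (G (tens x y)) <= `|x| * `|y|) ->
  (forall x y, G (F (tens x y)) = tens x y) ->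
  (forall x y, F (G (tens x y)) = tens x y) ->
  exists2 S : {linear proj_tensor X Y -> proj_tensor X Y},
    isometric_automorphisms S & forall u, S (inj u) = inj (F u).
Proof.
move=> Fle Gle FK GK.
apply: (@completion_isometry _ _ (proj_seminorm X Y) F G).
- exact: proj_norm_contraction.
- exact: proj_norm_contraction.
- move=> u; have [s ->] := tensor_eq_sum u.
  by rewrite !linear_sum; apply: eq_bigr => q _; exact: FK.
- move=> u; have [s ->] := tensor_eq_sum u.
  by rewrite !linear_sum; apply: eq_bigr => q _; exact: GK.
Qed.

Lemma proj_tensor_isometry_l (A : {linear X -> X}) : isometric_automorphisms A ->
  exists2 S : {linear proj_tensor X Y -> proj_tensor X Y},
    isometric_automorphisms S &
    forall x y, S (inj (tens x y)) = inj (tens (A x) y).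
Proof.
move=> Aiso; have [B [Biso AK BK]] := isometric_automorphism_inv Aiso.
have [I _ IE] := @isometric_automorphism_id _ Y.
have [F FE] := tensor_map A I; have [G GE] := tensor_map B I.
have [x y|x y|x y|x y|S Siso SE] := @proj_tensor_isometry F G.
- by rewrite FE IE (le_trans (proj_norm_tens _ _))// Aiso.1.
- by rewrite GE IE (le_trans (proj_norm_tens _ _))// Biso.1.
- by rewrite FE GE !IE AK.
- by rewrite GE FE !IE BK.
by exists S => // x y; rewrite SE FE IE.
Qed.

(** The twist acts as [T] on the range of [P] and trivially on its kernel. These two parts do not
    mix, so the twist by the inverse of [T] undoes it. *)
Lemma proj_tensor_isometry_L1 (P : {linear X -> X}) (T : {linear Y -> Y}) :
  L1_projection P -> isometric_automorphisms T ->
  exists2 S : {linear proj_tensor X Y -> proj_tensor X Y},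
    isometric_automorphisms S &
    forall x y, S (inj (tens x y)) = inj (tens (P x) (T y) + tens (x - P x) y).
Proof.
move=> [PP PN] Tiso; have [T' [T'iso TK T'K]] := isometric_automorphism_inv Tiso.
have [I _ IE] := @isometric_automorphism_id _ Y.
have [Q QE] : exists Q : {linear X -> X}, Q =1 (fun x => x - P x).
  by apply: linear_funP => a x x'; rewrite linearP scalerBr opprD addrACA.
(* Stated for any norm-preserving [B], so that it yields both the isometry and its inverse. *)
have twist (B : {linear Y -> Y}) : (forall y, `|B y| = `|y|) ->
    exists2 F : {linear tensor X Y -> tensor X Y},
      forall x y, F (tens x y) = tens (P x) (B y) + tens (x - P x) y &
      forall x y, proj_norm (F (tens x y)) <= `|x| * `|y|.
  move=> BN; have [F1 F1E] := tensor_map P B; have [F2 F2E] := tensor_map Q I.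
  have [F FE] : exists F : {linear tensor X Y -> tensor X Y},
      F =1 (fun u => F1 u + F2 u).
    by apply: linear_funP => a u v; rewrite !linearP scalerDr addrACA.
  have FE' x y : F (tens x y) = tens (P x) (B y) + tens (x - P x) y.
    by rewrite FE F1E F2E QE IE.
  exists F => // x y; rewrite FE' (le_trans (proj_normD _ _))// PN mulrDl.
  by rewrite -{1}(BN y) lerD ?proj_norm_tens.
have [F FE FN] := twist T Tiso.1; have [G GE GN] := twist T' T'iso.1.
have PQ x : P (x - P x) = 0 by rewrite linearB PP subrr.
have [//|//|x y|x y|S Siso SE] := @proj_tensor_isometry F G.
- rewrite FE linearD !GE PP PQ subrr subr0 TK !tens0l addr0 add0r.
  by rewrite -tensDl addrC subrK.
- rewrite GE linearD !FE PP PQ subrr subr0 T'K !tens0l addr0 add0r.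
  by rewrite -tensDl addrC subrK.
by exists S => // x y; rewrite SE FE.
Qed.

End projective_isometries.

(** * Additivity of the norm on separated vectors *)

Section L1_projections.
Context {R : realType} {X : normedModType R}.

(** By induction, the projection of the head index splits off the head term: it fixes that vector
    and kills all the others, which have different indices because [r] is duplicate-free. *)
Lemma L1_projections_norm_sum (I : eqType) (r : seq I) (c : I -> R) (z : I -> X)
    (P : I -> {linear X -> X}) : uniq r ->
  (forall i, L1_projection (P i)) -> (forall i, P i (z i) - z i = 0) ->
  (forall i j, i != j -> P i (z j) = 0) ->
  `|\sum_(i <- r) c i *: z i| = \sum_(i <- r) `|c i| * `|z i|.
Proof.
move=> + L1P /(_ _)/subr0_eq Pz Pz0; elim: r => [|i r ih] /=.
  by rewrite !big_nil normr0.
case/andP=> ir ur; rewrite !big_cons -(ih ur) (L1P i).2 linearD linearZ /= Pz.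
suff -> : P i (\sum_(j <- r) c j *: z j) = 0.
  by rewrite addr0 normrZ addrAC subrr add0r.
rewrite linear_sum big1_seq// => j /andP[_ jr]; rewrite linearZ /= Pz0 ?scaler0//.
by apply: contraNneq ir => ->.
Qed.

End L1_projections.

(** * Replacing factors inside a closed convex invariant set *)

Section main.
Context {R : realType} {X Y : normedModType R}.
Local Notation inj := (completion_inj (proj_seminorm X Y)).
Implicit Types (K : set (proj_tensor X Y)).

Lemma norm_inj_tens (x : X) (y : Y) : `|inj (tens x y)| <= `|x| * `|y|.
Proof. by rewrite norm_completion_inj; exact: proj_norm_tens. Qed.

(** The vectors [v] for which [tens z v] plus the fixed remainder lands in [K] form a closed convex
    set. It contains the orbit of [y], since the twist by [P] and [T] moves only the first term. *)
Lemma tens_term_replace K (P : {linear X -> X}) (z : X) (I : Type) (r : seq I)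
    (Q : pred I) (z' : I -> X) (w : I -> Y) (y y' : Y) :
  convex_transitive Y -> closed K -> convex K -> isom_invariant K ->
  L1_projection P -> P z = z -> (forall i, Q i -> P (z' i) = 0) ->
  `|y'| <= `|y| ->
  K (inj (tens z y + \sum_(i <- r | Q i) tens (z' i) (w i))) ->
  K (inj (tens z y' + \sum_(i <- r | Q i) tens (z' i) (w i))).
Proof.
move=> trY clK cK iK L1P Pz Pz' y'y; set rest := \sum_(i <- r | _) _ => Ky.
pose f v := inj (tens z v + rest).
apply: (@convex_transitive_sub R Y [set v | K (f v)] y y') => //.
- refine (closed_preimage_lip (f := f) (c := `|z|) clK _) => u v.
  by rewrite /f -linearB /= opprD addrACA subrr addr0 -linearB norm_inj_tens.
- move=> s t u v s0 t0 st Ku Kv /=.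
  suff -> : f (s *: u + t *: v) = s *: f u + t *: f v by exact: cK.
  rewrite /f -!linearZ -linearD /=; congr inj.
  (* [f] is affine, not linear: the remainder is reproduced because [s + t = 1]. *)
  rewrite !scalerDr addrACA -scalerDl st scale1r; congr (_ + _).
  by rewrite linearD !linearZ.
- move=> T Tiso /=; have [S Siso SE] := proj_tensor_isometry_L1 L1P Tiso.
  suff -> : f (T y) = S (f y) by exact: iK.
  rewrite /f /rest !linearD !linear_sum /= SE Pz subrr tens0l addr0.
  congr (_ + _); apply: eq_bigr => i Qi.
  by rewrite SE Pz'// tens0l subr0 add0r.
Qed.

Lemma tens_sum_replace K (k : nat) (z : 'I_k -> X)
    (P : 'I_k -> {linear X -> X}) (y y' : 'I_k -> Y) :
  convex_transitive Y -> closed K -> convex K -> isom_invariant K ->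
  (forall i, L1_projection (P i)) -> (forall i, P i (z i) - z i = 0) ->
  (forall i j, i != j -> P i (z j) = 0) ->
  (forall i, `|y' i| <= `|y i|) ->
  K (inj (\sum_i tens (z i) (y i))) -> K (inj (\sum_i tens (z i) (y' i))).
Proof.
move=> trY clK cK iK L1P Pz Pz0 y'y Ky.
(* Replacement proceeds one index at a time; after [n] rounds exactly the indices below [n] carry
   [y']. *)
have /(_ k) : forall n,
    K (inj (\sum_i tens (z i) (if (i < n)%N then y' i else y i))).
  elim=> [//|n ih]; have [kn|nk] := leqP k n.
    move: ih; congr (K (inj _)); apply: eq_bigr => i _.
    by rewrite !(leq_trans (ltn_ord i))// ltnW.
  pose i0 := Ordinal nk; move: ih; rewrite (bigD1 i0)//= ltnn => ih.
  rewrite (bigD1 i0)//= ltnSn.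
  have -> : \sum_(i | i != i0) tens (z i) (if (i < n.+1)%N then y' i else y i) =
            \sum_(i | i != i0) tens (z i) (if (i < n)%N then y' i else y i).
    apply: eq_bigr => i ii0; rewrite ltnS leq_eqVlt.
    by rewrite -[i == n :> nat]/(i == i0) (negbTE ii0).
  apply: (@tens_term_replace K (P i0) _ _ _ _ _ _ (y i0)) => //.
    exact: subr0_eq.
  by move=> i ii0; rewrite Pz0// eq_sym.
by congr (K (inj _)); apply: eq_bigr => i _; rewrite ltn_ord.
Qed.

Lemma tens_sum_absorb K (k : nat) (z : 'I_k -> X)
    (P : 'I_k -> {linear X -> X}) (y : 'I_k -> Y) (x' : X) (y' : Y) :
  convex_transitive X -> convex_transitive Y ->
  closed K -> convex K -> isom_invariant K ->
  (forall i, L1_projection (P i)) -> (forall i, P i (z i) - z i = 0) ->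
  (forall i j, i != j -> P i (z j) = 0) ->
  `|x'| * `|y'| <= \sum_i `|z i| * `|y i| ->
  K (inj (\sum_i tens (z i) (y i))) -> K (inj (tens x' y')).
Proof.
move=> trX trY clK cK iK L1P Pz Pz0 le_xy Ky.
(* A zero [y'] has no direction to normalise; here every [y i] is replaced by 0. *)
have [->|y'_neq0] := eqVneq y' 0.
  have -> : tens x' 0 = \sum_i tens (z i) (0 : Y).
    by rewrite linear0 big1// => i _; rewrite linear0.
  by apply: (@tens_sum_replace K k z P y) => // i; rewrite normr0.
have ny' : `|y'| != 0 by rewrite normr_eq0.
have [y0 y01 y'E] : exists2 y0, `|y0| = 1 & y' = `|y'| *: y0.
  exists (`|y'|^-1 *: y'); first by rewrite normrZ normfV normr_id mulVf.
  by rewrite scalerA divff// scale1r.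
pose x1 := \sum_i `|y i| *: z i.
have Kx1 : K (inj (tens x1 y0)).
  have -> : tens x1 y0 = \sum_i tens (z i) (`|y i| *: y0).
    by rewrite tens_suml; apply: eq_bigr => i _; rewrite tensZl -tensZr.
  apply: (@tens_sum_replace K k z P y) => // i.
  by rewrite normrZ normr_id y01 mulr1.
(* The length of [y'] moves to the first factor, leaving the unit vector [y0] shared with [x1]. *)
have -> : tens x' y' = tens (`|y'| *: x') y0.
  by rewrite {1}y'E tensZl tensZr.
apply: (@convex_transitive_sub R X [set x | K (inj (tens x y0))] x1) => //.
- pose f x := inj (tens x y0).
  refine (closed_preimage_lip (f := f) (c := 1) clK _) => u v; rewrite /f.
  rewrite -linearB /= -(linearB (tensl y0)) (le_trans (norm_inj_tens _ _))//.
  by rewrite y01 mulr1 mul1r.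
- move=> s t u v s0 t0 st Ku Kv /=.
  by rewrite tensDl !tensZl linearD !linearZ; exact: cK.
- move=> T Tiso /=; have [S Siso SE] := @proj_tensor_isometry_l R X Y T Tiso.
  by rewrite -SE; exact: iK.
rewrite normrZ normr_id mulrC (le_trans le_xy)//.
rewrite (L1_projections_norm_sum _ (index_enum_uniq _) L1P Pz Pz0).
by apply: ler_sum => i _; rewrite normr_id mulrC.
Qed.

(** * Approximation by finite sums of elementary tensors *)

Lemma tens_normalize (x : X) (y : Y) :
  tens x y = (`|x| * `|y|) *: tens (`|x|^-1 *: x) (`|y|^-1 *: y).
Proof.
rewrite tensZl tensZr !scalerA.
(* The inverse of 0 is 0, so both sides vanish when a factor is zero. *)
have [->|x0] := eqVneq x 0; first by rewrite tens0l !scaler0.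
have [->|y0] := eqVneq y 0; first by rewrite linear0 !scaler0.
rewrite -[LHS]scale1r; congr (_ *: _).
by field; rewrite !normr_eq0 x0 y0.
Qed.

(** A vector of the ball is near an algebraic tensor of norm below [1 + e / 2], which is a
    nonnegative combination of normalised elementary tensors with total weight below [1 + e / 2]. *)
Lemma unit_ball_sub K : closed K -> convex K ->
  (forall (x : X) (y : Y), `|x| * `|y| <= 1 -> K (inj (tens x y))) ->
  [set w | `|w| <= 1] `<=` K.
Proof.
move=> clK cK Ktens w /= w1; apply: clK; apply/closureP => e e0.
have e20 : 0 < e / 2 by rewrite divr_gt0.
have : closure (range inj) w by rewrite completion_inj_dense.
move=> /closureP/(_ _ e20)[_ [t _ <-] wt].
have t1 : proj_norm t < 1 + e / 2.
  rewrite -[proj_norm t](norm_completion_inj (proj_seminorm X Y)).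
  rewrite -(subrK w (inj t)) (le_lt_trans (ler_normD _ _))// addrC.
  by rewrite ler_ltD// distrC.
have [s tE sc] := proj_norm_lt t1.
have K0 : K 0 by have := Ktens 0 0; rewrite tens0l linear0 normr0 mul0r; apply.
pose unit_tens (p : X * Y) := inj (tens (`|p.1|^-1 *: p.1) (`|p.2|^-1 *: p.2)).
have mulVle1 (r : R) : r^-1 * r <= 1.
  by have [->|r0] := eqVneq r 0; rewrite ?mulr0 ?mulVf.
have Kunit p : K (unit_tens p).
  apply: Ktens; rewrite !normrZ !normfV !normr_id.
  by rewrite mulr_ile1 ?mulr_ge0 ?invr_ge0.
have [z Kz zE] := @convex_sum _ _ K _ s (fun p => `|p.1| * `|p.2|) unit_tens cK
  (ex_intro _ 0 K0) (fun p => mulr_ge0 (normr_ge0 _) (normr_ge0 _)) Kunit.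
have {}zE : inj t = formal_cost s *: z.
  rewrite -zE tE linear_sum; apply: eq_bigr => -[x y] _ /=.
  by rewrite -linearZ -tens_normalize.
have fe : 0 < 1 + e / 2 by rewrite ltr_wpDl.
(* Dividing [inj t] by [1 + e / 2] gives a convex combination of [z] and 0, hence a point of [K], at
   distance at most [e / 2] from [inj t]. *)
exists ((formal_cost s / (1 + e / 2)) *: z).
  have /cK : 0 <= formal_cost s / (1 + e / 2).
    by rewrite divr_ge0 ?formal_cost_ge0// ltW.
  move=> /(_ (1 - formal_cost s / (1 + e / 2)) z 0).
  rewrite scaler0 addr0; apply=> //.
    by rewrite subr_ge0 ler_pdivrMr// mul1r ltW.
  by rewrite addrC subrK.
rewrite mulrC -scalerA -zE -(subrK (inj t) w) -addrA.
rewrite (le_lt_trans (ler_normD _ _))// [ltRHS]splitr ltr_leD//.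
have -> : inj t - (1 + e / 2)^-1 *: inj t = (e / 2 / (1 + e / 2)) *: inj t.
  rewrite -{1}(scale1r (inj t)) -scalerBl; congr (_ *: _).
  by field; rewrite gt_eqF// addr_gt0.
have f0 : 0 <= e / 2 / (1 + e / 2) by rewrite divr_ge0 ?ltW.
rewrite normrZ (ger0_norm f0) -[leRHS](mulfVK (lt0r_neq0 fe)) ler_wpM2l//.
by rewrite norm_completion_inj ltW.
Qed.

(** After [u] is replaced by a finite sum of elementary tensors, the first factors are approximated
    in the span of the [z i] and the sum is regrouped by [z i]. *)
Lemma L_like_approx (u : proj_tensor X Y) (d : R) : L_like X -> 0 < d ->
  exists (k : nat) (z : 'I_k -> X) (P : 'I_k -> {linear X -> X}) (y : 'I_k -> Y),
    [/\ forall i, L1_projection (P i), forall i, P i (z i) - z i = 0,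
        forall i j, i != j -> P i (z j) = 0 &
        `|u - inj (\sum_i tens (z i) (y i))| < d].
Proof.
move=> likeX d0; have d20 : 0 < d / 2 by rewrite divr_gt0.
have : closure (range inj) u by rewrite completion_inj_dense.
move=> /closureP/(_ _ d20)[_ [t _ <-] ut].
have [s tE] := tensor_eq_sum t.
pose x (m : 'I_(size s)) := (tnth (in_tuple s) m).1.
pose w (m : 'I_(size s)) := (tnth (in_tuple s) m).2.
have {}tE : t = \sum_m tens (x m) (w m) by rewrite tE big_tnth.
pose L := \sum_m `|w m|.
have L1 : 0 < L + 1 by rewrite ltr_wpDl// sumr_ge0.
(* With tolerance [d / 2 / (L + 1)] the errors weighted by [|w m|] add up to at most [d / 2]; the 1
   covers [L = 0]. *)
have [k [z [P [L1P zx Pz Pz0]]]] := likeX _ _ x (divr_gt0 d20 L1).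
have /choice[c cx] m : exists c : 'I_k -> R,
    `|x m - \sum_i c i *: z i| < d / 2 / (L + 1).
  have /ereal_inf_lt[_ [_ [c _ <-] <-] /edist_lt_ball] := zx m.
  by rewrite -ball_normE /= => xc; exists c.
exists k, z, P, (fun i => \sum_m c m i *: w m); split=> //.
have -> : \sum_i tens (z i) (\sum_m c m i *: w m) =
    \sum_m tens (\sum_i c m i *: z i) (w m).
  under eq_bigr do rewrite linear_sum.
  rewrite exchange_big /=; apply: eq_bigr => m _; rewrite tens_suml.
  by apply: eq_bigr => i _; rewrite tensZl tensZr.
rewrite -(subrK (inj t) u) -addrA (le_lt_trans (ler_normD _ _))//.
rewrite [ltRHS]splitr ltr_leD// -linearB norm_completion_inj tE -sumrB /=.
apply: (le_trans (proj_norm_sum _ _)).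
apply: (@le_trans _ _ (\sum_m d / 2 / (L + 1) * `|w m|)).
  apply: ler_sum => m _; rewrite -(linearB (tensl (w m))).
  by rewrite (le_trans (proj_norm_tens _ _))// ler_wpM2r// ltW.
rewrite -mulr_sumr -/L mulrAC ler_pdivrMr// ler_wpM2l ?(ltW d20)//.
by rewrite lerDl.
Qed.

End main.

(** * The orbit hull of a unit vector fills the unit ball *)

Theorem theorem4p2 (R : realType) (X Y : normedModType R)
    (X_convex_transitive : convex_transitive X)
    (Y_convex_transitive : convex_transitive Y)
    (X_L_like : L_like X) :
  convex_transitive (proj_tensor X Y).
Proof.
move=> u u1; apply/seteqP; split=> [w /orbit_hull_norm|]; first by rewrite u1.
have clK : closed (orbit_hull u) by exact: closed_closure.
apply: unit_ball_sub => //; first exact: convex_orbit_hull.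
move=> x y xy1; apply: clK; apply/closureP => e e0.
(* Three errors of size [d] have to fit into [e], and [d < 1] keeps the factor [1 - d] positive. *)
have [d /andP[d0 d1] de] : exists2 d : R, 0 < d < 1 & 3 * d <= e.
  have e3 : 0 < 3 + e by rewrite addr_gt0.
  exists (e / (3 + e)); first by rewrite divr_gt0//= ltr_pdivrMr// mul1r ltrDr.
  by rewrite mulrA ler_pdivrMr// mulrC ler_pM2l// lerDl ltW.
have [k [z [P [v [L1P Pz Pz0 uv]]]]] := L_like_approx u X_L_like d0.
(* The approximant of [u] need not lie in the orbit hull, but it lies in this neighbourhood, which
   is still convex and invariant. *)
pose K := closure (fatten (orbit_hull u) d).
(* The approximant has norm at least [1 - d], so only tensors of norm at most [1 - d] are reached;
   hence the shrinking of [x]. *)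
have : K (completion_inj _ (tens ((1 - d) *: x) y)).
  apply: (tens_sum_absorb (K := K) X_convex_transitive Y_convex_transitive _ _ _
    L1P Pz Pz0 (y := v)).
  - exact: closed_closure.
  - by apply/convex_closure/convex_fatten/convex_orbit_hull.
  - by apply/isom_invariant_closure/isom_invariant_fatten/isom_invariant_orbit_hull.
  - rewrite normrZ -mulrA (@le_trans _ _ (1 - d))//.
      by rewrite gtr0_norm ?subr_gt0// ler_piMr// subr_ge0 ltW.
    rewrite lerBlDr -u1 -{1}(subrK (completion_inj _ (\sum_i tens (z i) (v i))) u).
    rewrite (le_trans (ler_normD _ _))// addrC lerD//; last exact: ltW.
    rewrite norm_completion_inj; apply: (le_trans (proj_norm_sum _ _)).
    by apply: ler_sum => i _; exact: proj_norm_tens.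
  - apply: subset_closure; exists u; first exact: orbit_hull_refl.
    by rewrite distrC.
move=> /closureP/(_ _ d0)[b [a Ka ba] tb]; exists a => //.
set t := completion_inj _ (tens x y).
have td : `|t - (1 - d) *: t| <= d.
  rewrite -{1}(scale1r t) -scalerBl opprB addrC subrK normrZ gtr0_norm//.
  by rewrite ler_piMr ?(ltW d0)// (le_trans (norm_inj_tens _ _)).
rewrite tensZl linearZ -/t /= in tb.
(* The errors come from shrinking [x], from the closure and from the fattening. *)
have -> : t - a = (t - (1 - d) *: t) + (((1 - d) *: t - b) + (b - a)).
  by rewrite !addrA !subrK.
rewrite (le_lt_trans (ler_normD _ _))//.
have := ler_normD ((1 - d) *: t - b) (b - a); move: ba tb td de.
lra.
Qed.
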